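(* Let $\mathbb{F}_m=\mathbb{R}^m\times\wedge^2\mathbb{R}^m$ be the free two-step Carnot group with $m$ generators, with group law $(x,t)\cdot(\xi,\tau)=(x+\xi,\ t+\tau+\frac12x\wedge\xi)$, and let $d$ be the subRiemannian distance from the origin. Let $(x,t)=\gamma(1)$, where $\gamma:[0,1]\to\mathbb{F}_m$ is an abnormal length-minimizing path with $\gamma(0)=(0,0)$, and suppose $d(x,t)=1$. Then there are positive constants $C$ and $\delta$ such that $$\sup_{\substack{y\in\mathbb{R}^m\\ 0<|y|\le\delta}}\frac{d\bigl(e^{y\cdot X}(x,t)\bigr)+d\bigl(e^{-y\cdot X}(x,t)\bigr)-2d(x,t)}{|y|^2}\le C.$$
   Context: $X_1,\dots,X_m$ are the left-invariant vector fields on $\mathbb{F}_m$ that agree with $\partial_{x_1},\dots,\partial_{x_m}$ at the origin, $y\cdot X:=\sum_{j=1}^m y_jX_j$, and $e^{y\cdot X}(x,t)$ is the value at time $1$ of the integral curve of $y\cdot X$ starting from $(x,t)$; thus $e^{y\cdot X}(x,t)=(x,t)\cdot(y,0)=(x+y,\ t+\frac12x\wedge y)$. Distance. A horizontal path is a $W^{1,2}$ path $\gamma$ on $(0,1)$ for which there is a control $u\in L^2((0,1),\mathbb{R}^m)$ with $\dot\gamma(s)=\sum_ju_j(s)X_j(\gamma(s))$ for a.e. $s$; its length is $\int_0^1|u(s)|\,ds$. The subRiemannian distance between two points is the infimum of lengths of horizontal paths joining them. A path is length-minimizing if it is horizontal and its length equals the distance between its endpoints. Abnormality. For $u\in L^2((0,1),\mathbb{R}^m)$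 let $\gamma_u$ be the horizontal path with control $u$ and $\gamma_u(0)=(0,0)$, and let $E(u)=\gamma_u(1)$ be the (smooth) endpoint map. The path $\gamma_u$ is abnormal if the differential $dE(u):L^2((0,1),\mathbb{R}^m)\to\mathbb{R}^m\times\wedge^2\mathbb{R}^m$ is not onto. *)

(* Defs.v *)
From HB Require Import structures.
From mathcomp Require Import all_boot all_order all_algebra.
From mathcomp Require Import all_classical all_reals all_analysis.

Set Implicit Arguments.
Unset Strict Implicit.
Unset Printing Implicit Defensive.

Import Order.TTheory GRing.Theory Num.Theory.
Import numFieldNormedType.Exports.

Local Open Scope classical_set_scope.
Local Open Scope ring_scope.

(* wedge^2 R^m is given by its coordinates in the basis e_i /\ e_j, i < j. *)
Definition wedge_index (m : nat) : finType :=
  {p : 'I_m * 'I_m | (p.1 < p.2)%N}.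
Definition wedge_dim (m : nat) : nat := #|wedge_index m|.

Notation free_carnot R m := ('rV[R]_m * 'rV[R]_(wedge_dim m))%type.

Section FreeCarnot.
Context {R : realType} {m : nat}.

(* The canonical norm of 'rV[R]_n in the library is the sup norm. *)
Definition enorm n (y : 'rV[R]_n) : R := Num.sqrt (\sum_i y 0 i ^+ 2).

Definition wedge (x y : 'rV[R]_m) : 'rV[R]_(wedge_dim m) :=
  \row_k let: (i, j) := val (enum_val k : wedge_index m) in
         x 0 i * y 0 j - x 0 j * y 0 i.

Local Notation free_carnot := (free_carnot R m).

Definition carnot_mul (p q : free_carnot) : free_carnot :=
  (p.1 + q.1, p.2 + q.2 + 2^-1 *: wedge p.1 q.1).

(* X_j(p) is the image of d/dx_j at the origin under the differential at the
   origin of the left translation by p; explicitly, (e_j, (1/2) p.1 /\ e_j). *)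
Definition lfield (j : 'I_m) (p : free_carnot) : free_carnot :=
  'D_((delta_mx 0 j, 0) : free_carnot) (carnot_mul p) (0 : free_carnot).

(* y . X *)
Definition hfield (y : 'rV[R]_m) (p : free_carnot) : free_carnot :=
  \sum_j y 0 j *: lfield j p.

Definition integral_curve (Z : free_carnot -> free_carnot)
    (c : R -> free_carnot) : Prop :=
  forall s : R, is_derive s 1 c (Z (c s)).

(* e^{y . X}(p): the integral curve exists and is unique, so that the default
   value of xget is never used. *)
Definition hexp (y : 'rV[R]_m) (p : free_carnot) : free_carnot :=
  xget (fun=> p) [set c | integral_curve (hfield y) c /\ c 0 = p] 1.

Notation leb := (@lebesgue_measure R).
Notation I01 := (`]0%R, 1%R[%classic : set R).

(* Elements of L^2 are represented by functions on the line, of which only the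
   values on (0,1) matter. *)
Definition L2 (f : R -> R) : Prop :=
  measurable_fun I01 f /\ (\int[leb]_(s in I01) ((f s ^+ 2)%:E) < +oo)%E.

Definition L2v n (u : R -> 'rV[R]_n) : Prop := forall i, L2 (fun s => u s 0 i).

Definition L2norm n (u : R -> 'rV[R]_n) : R :=
  Num.sqrt (\int[leb]_(s in I01) (enorm (u s) ^+ 2)).

(* C^1 functions with compact support in (0,1) *)
Definition test_function (phi : R -> R) : Prop :=
  [/\ forall s, derivable phi s 1,
      continuous (derive1 phi) &
      exists a b : R, [/\ 0 < a, b < 1 &
        forall s, ~ (a <= s <= b) -> phi s = 0]].

(* f belongs to W^{1,2}(0,1), with weak derivative g *)
Definition W12 (f g : R -> R) : Prop :=
  [/\ L2 f, L2 g &
      forall phi, test_function phi ->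
        \int[leb]_(s in I01) (f s * derive1 phi s) =
        - \int[leb]_(s in I01) (g s * phi s)].

(* A W^{1,2} path is identified with its continuous representative on [0,1],
   so that it has endpoints. *)
Definition W12_path (c dc : R -> free_carnot) : Prop :=
  [/\ {within `[0, 1], continuous c},
      forall i, W12 (fun s => (c s).1 0 i) (fun s => (dc s).1 0 i) &
      forall k, W12 (fun s => (c s).2 0 k) (fun s => (dc s).2 0 k)].

(* c is a horizontal path with control u *)
Definition horizontal (c : R -> free_carnot) (u : R -> 'rV[R]_m) : Prop :=
  L2v u /\
  exists2 dc, W12_path c dc &
    {ae leb, forall s, I01 s -> dc s = \sum_j u s 0 j *: lfield j (c s)}.

(* length of a horizontal path with control u *)
Definition hlength (u : R -> 'rV[R]_m) : \bar R :=
  (\int[leb]_(s in I01) ((enorm (u s))%:E))%E.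

Definition ccdist (p q : free_carnot) : \bar R :=
  ereal_inf [set l | exists c u,
    [/\ horizontal c u, c 0 = p, c 1 = q & l = hlength u]].

Definition ccdist0 (p : free_carnot) : \bar R := ccdist 0 p.

(* The endpoint map; for u in L^2, the path gamma_u exists and is unique on
   [0,1], so that the default value of xget is not used. *)
Definition endpoint (u : R -> 'rV[R]_m) : free_carnot :=
  xget (fun=> 0) [set c | horizontal c u /\ c 0 = 0] 1.

(* D is the (Frechet) differential at u of the endpoint map on L^2; only its
   values on L^2 matter. *)
Definition endpoint_diff (u : R -> 'rV[R]_m)
    (D : (R -> 'rV[R]_m) -> free_carnot) : Prop :=
  [/\ forall (a : R) v w, L2v v -> L2v w ->
        D (fun s => a *: v s + w s) = a *: D v + D w,
      exists K : R, forall v, L2v v -> `|D v| <= K * L2norm v &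
      forall eps : R, 0 < eps -> exists2 delta : R, 0 < delta &
        forall v, L2v v -> L2norm v <= delta ->
        `|endpoint (fun s => u s + v s) - endpoint u - D v|
          <= eps * L2norm v].

Definition abnormal (u : R -> 'rV[R]_m) : Prop :=
  exists2 D, endpoint_diff u D &
    ~ (forall q : free_carnot, exists2 v, L2v v & D v = q).

End FreeCarnot.

(* Main.v *)
Require Import Defs.
From mathcomp Require Import all_boot all_order all_algebra.
From mathcomp Require Import all_classical all_reals all_analysis.
From mathcomp Require Import measurable_realfun ring lra.
Import Order.TTheory GRing.Theory Num.Theory.
Import numFieldNormedType.Exports.
Local Open Scope classical_set_scope.
Local Open Scope ring_scope.

(** Let gamma be a path from the origin to p with control u, and let x be its
    projection to R^m.  Adding psi y to the control u, for a scalar function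
    psi, changes the endpoint by a term linear in y only: the quadratic term
    vanishes because y wedge y = 0.  If

      int_0^1 psi = 1   and   int_0^1 psi x = x(1),

    an integration by parts shows that the new endpoint is exactly
    e^{y.X}(p) (hlift_perturb).  The same psi serves for y and for - y, so

      d(e^{y.X}(p)) + d(e^{-y.X}(p)) <= int |u + psi y| + int |u - psi y|.

    If moreover psi = |u| phi with phi bounded, the parallelogram identity
    bounds the right-hand side by 2 int |u| + |y|^2 int |u| phi^2
    (enorm_second_difference), and int |u| = d(p) when gamma is a minimizer.

    Such a phi exists in the span of 1, x_1, ..., x_m (exists_weight).  The two
    conditions on psi form a linear system whose matrix is the Gram matrix of
    1, x_1, ..., x_m in L^2(|u| ds); it is solvable as soon as every affine
    function g = c + a.x with int g^2 |u| = 0 vanishes at time 1.  Almost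
    everywhere, g = 0 or u = 0, and in the second case g' = a.u = 0; so
    g g' = 0, g^2 is constant, and the constant is 0 because
    g^2 int |u| = int g^2 |u|.

    The analytic substance is that horizontal paths, which are defined by weak
    derivatives, are the primitives of their velocities: du_Bois_Reymond shows
    that a path is determined by its control (horizontal_endpoint), and Fubini's
    theorem shows that primitives are weakly differentiable and may be
    integrated by parts (prim_by_parts). *)

Set Implicit Arguments.
Unset Strict Implicit.
Unset Printing Implicit Defensive.

Local Notation leb := (@lebesgue_measure _).
Local Notation I01 := (`]0%R, 1%R[%classic : set (Real.sort _)).
Local Notation J01 := (`[0%R, 1%R]%classic : set (Real.sort _)).
Local Notation integrable01 f :=
  (leb.-integrable I01 (EFin \o (f : Real.sort _ -> Real.sort _))).

(** * The group law and the horizontal fields *)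

(** The difference quotients of an affine function are constant, in particular
    near 0, so that no continuity of the linear part has to be proved. *)
Lemma is_derive_affine (R : realType) (V W : normedModType R) (f : V -> W)
    (a v : V) (w : W) :
  (forall h : R, f (h *: v + a) - f a = h *: w) -> is_derive a v f w.
Proof.
move=> fE.
have Hcvg : h^-1 *: (f (h *: v + a) - f a) @[h --> 0^'] --> w.
  apply: cvg_near_cst; near=> h.
  rewrite fE scalerA mulVf ?scale1r//.
  by near: h; exact: nbhs_dnbhs_neq.
by apply: DeriveDef; [apply: (cvgP w)|apply: cvg_lim].
Unshelve. all: by end_near. Qed.

Lemma is_derive_linear_comp (R : realType) (V : normedModType R)
    (L : V -> R) (c : R -> V) (s : R) (w : V) :
  continuous L -> {morph L : p q / p - q} ->
    (forall a p, L (a *: p) = a * L p) ->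
  is_derive s 1 c w -> is_derive s 1 (L \o c) (L w).
Proof.
move=> Lc LB LZ [dc dcE].
have Hcvg : h^-1 *: (L (c (h *: 1 + s)) - L (c s)) @[h --> 0^'] --> L w.
  have -> : (fun h : R => h^-1 *: (L (c (h *: 1 + s)) - L (c s))) =
      L \o (fun h : R => h^-1 *: (c (h *: 1 + s) - c s)).
    by apply/funext => h /=; rewrite LZ LB.
  apply: continuous_cvg; first exact: Lc.
  by rewrite -dcE; exact: dc.
by apply: DeriveDef; [apply: (cvgP (L w))|apply: cvg_lim].
Qed.

Section geometry.
Context {R : realType} {m : nat}.
Notation G := (free_carnot R m).

Lemma wedgeDr (x y z : 'rV[R]_m) : wedge x (y + z) = wedge x y + wedge x z.
Proof.
by apply/rowP => k; rewrite !mxE; case: (val _) => i j; rewrite !mxE; ring.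
Qed.

Lemma wedgeZr (x y : 'rV[R]_m) a : wedge x (a *: y) = a *: wedge x y.
Proof.
by apply/rowP => k; rewrite !mxE; case: (val _) => i j; rewrite !mxE; ring.
Qed.

Lemma wedgeDl (x y z : 'rV[R]_m) : wedge (x + y) z = wedge x z + wedge y z.
Proof.
by apply/rowP => k; rewrite !mxE; case: (val _) => i j; rewrite !mxE; ring.
Qed.

Lemma wedgeZl (x y : 'rV[R]_m) a : wedge (a *: x) y = a *: wedge x y.
Proof.
by apply/rowP => k; rewrite !mxE; case: (val _) => i j; rewrite !mxE; ring.
Qed.

Lemma wedge_self (x : 'rV[R]_m) : wedge x x = 0.
Proof.
by apply/rowP => k; rewrite !mxE; case: (val _) => i j; rewrite mulrC subrr.
Qed.

Lemma lfieldE (j : 'I_m) (p : G) :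
  lfield j p = (delta_mx 0 j, 2^-1 *: wedge p.1 (delta_mx 0 j)).
Proof.
rewrite /lfield; apply: derive_val.
apply: is_derive_affine => h; congr (_, _) => /=.
  by rewrite !addr0 addrC addKr.
rewrite scaler0 !addr0 wedgeZr.
have -> : wedge p.1 (0 : 'rV[R]_m) = 0.
  by rewrite -(scale0r (0 : 'rV[R]_m)) wedgeZr scale0r.
by rewrite scaler0 addr0 addrC addKr !scalerA mulrC.
Qed.

Lemma hfieldE (y : 'rV[R]_m) (p : G) :
  hfield y p = (y, 2^-1 *: wedge p.1 y).
Proof.
have sum1 (I : Type) (r : seq I) (F : I -> G) :
    \sum_(i <- r) F i = (\sum_(i <- r) (F i).1, \sum_(i <- r) (F i).2).
  rewrite [LHS]surjective_pairing.
  by congr pair; apply: (big_morph _ (id1 := 0)).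
rewrite /hfield sum1; under eq_bigr do rewrite lfieldE /=.
under [X in (_, X)]eq_bigr do rewrite lfieldE /= scalerA mulrC -scalerA
  -wedgeZr.
rewrite -scaler_sumr.
have -> : \sum_(i < m) wedge p.1 (y 0 i *: delta_mx 0 i) =
          wedge p.1 (\sum_(i < m) y 0 i *: delta_mx 0 i).
  apply/esym; apply: (big_morph (wedge p.1)); first exact: wedgeDr.
  by rewrite -(scale0r (0 : 'rV[R]_m)) wedgeZr scale0r.
by rewrite -row_sum_delta.
Qed.

(** The integral curves of a constant horizontal field have constant velocity,
    because the wedge of a vector with itself vanishes. *)
Lemma integral_curve_hfield (y : 'rV[R]_m) (p : G) (c : R -> G) :
  integral_curve (hfield y) c /\ c 0 = p <->
  c = (fun s : R => (p.1 + s *: y, p.2 + s *: (2^-1 *: wedge p.1 y))).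
Proof.
split=> [[cy c0]|->]; last first.
  split; last by rewrite !scale0r !addr0 -surjective_pairing.
  move=> s; rewrite hfieldE /= wedgeDl wedgeZl wedge_self scaler0 addr0.
  apply: is_derive_affine => h; congr (_, _) => /=.
    by rewrite opprD addrACA subrr add0r -scalerBl addrK -[h *: 1]/(h * 1)
      mulr1.
  by rewrite opprD addrACA subrr add0r -scalerBl addrK -[h *: 1]/(h * 1) mulr1.
have cur s := hfieldE y (c s).
have affine (L : G -> R) (k : R) : continuous L -> {morph L : p q / p - q} ->
    (forall a p, L (a *: p) = a * L p) -> (forall s, L (hfield y (c s)) = k) ->
    forall s, L (c s) = L p + s * k.
  move=> Lc LB LZ Lk s.
  have d (t : R) : is_derive t (1 : R) (L \o c - ( *%R^~ k)) 0.
    have -> : 0 = L (hfield y (c t)) - k by rewrite Lk subrr.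
    apply: is_deriveB; first exact: is_derive_linear_comp.
    apply: is_derive_affine => h.
    by rewrite mulrDl addrK -[h *: 1]/(h * 1) mulr1.
  have := is_derive_0_is_cst s 0 d.
  rewrite !fctE /= c0 mul0r subr0 => <-; ring.
have c1E s : (c s).1 = p.1 + s *: y.
  apply/rowP => i; rewrite !mxE.
  apply: (affine (fun q : G => q.1 0 i)) => [q|a b|a b|r].
  - apply: (@continuous_comp G 'rV[R]_m R fst (fun M => M 0 i)).
      exact: cvg_fst.
    exact: coord_continuous.
  - by rewrite !mxE.
  - by rewrite !mxE.
  - by rewrite hfieldE.
apply/funext => s; rewrite [LHS]surjective_pairing; congr pair;
  first exact: c1E.
apply/rowP => k; rewrite [RHS]mxE [in RHS]mxE.
apply: (affine (fun q : G => q.2 0 k)) => [q|a b|a b|r].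
- apply: (@continuous_comp G 'rV[R]_(wedge_dim m) R snd (fun M => M 0 k)).
    exact: cvg_snd.
  exact: coord_continuous.
- by rewrite !mxE.
- by rewrite !mxE.
- by rewrite hfieldE /= c1E wedgeDl wedgeZl wedge_self scaler0 addr0.
Qed.

(** The flow of y.X is the right translation by (y, 0). *)
Lemma hexpE (y : 'rV[R]_m) (p : G) :
  hexp y p = (p.1 + y, p.2 + 2^-1 *: wedge p.1 y).
Proof.
rewrite /hexp; set c := xget _ _.
have : [set c | integral_curve (hfield y) c /\ c 0 = p] c.
  rewrite /c; case: xgetP => [d _ //|none].
  by case: (none _ ((integral_curve_hfield y p _).2 erefl)).
by move=> /integral_curve_hfield ->; rewrite !scale1r.
Qed.

End geometry.

(** * Exchange of integrals *)

Section fubini.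
Context d1 d2 (T1 : measurableType d1) (T2 : measurableType d2) (R : realType).
Context (m1 : {sigma_finite_measure set T1 -> \bar R}).
Context (m2 : {sigma_finite_measure set T2 -> \bar R}).

(** Integrability of every section makes the inner integrals finite everywhere,
    so that passing from extended real to real integrals loses nothing. *)
Lemma Rintegral_exchange (F : T1 -> T2 -> R) :
  (m1 \x m2)%E.-integrable setT (fun z => (F z.1 z.2)%:E) ->
  (forall x, m2.-integrable setT (EFin \o F x)) ->
  (forall y, m1.-integrable setT (EFin \o F^~ y)) ->
  \int[m1]_x \int[m2]_y F x y = \int[m2]_y \int[m1]_x F x y.
Proof.
move=> intF intx inty; have := Fubini intF.
rewrite /Rintegral => /(congr1 fine) /=.
have xE x : (\int[m2]_y (F x y)%:E = (fine (\int[m2]_y (F x y)%:E))%:E)%E.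
  by rewrite fineK//; apply: integrable_fin_num (intx x).
have yE y : (\int[m1]_x (F x y)%:E = (fine (\int[m1]_x (F x y)%:E))%:E)%E.
  by rewrite fineK//; apply: integrable_fin_num (inty y).
rewrite (eq_integral _ _ (fun x _ => xE x)) => ->.
by rewrite (eq_integral _ _ (fun y _ => yE y)).
Qed.

Lemma integrable_prod (f : T1 -> R) (g : T2 -> R) :
  m1.-integrable setT (EFin \o f) -> m2.-integrable setT (EFin \o g) ->
  (m1 \x m2)%E.-integrable setT (fun z => (f z.1 * g z.2)%:E).
Proof.
move=> intf intg.
have mf : measurable_fun setT f by apply/measurable_EFinP;
  exact: measurable_int intf.
have mg : measurable_fun setT g by apply/measurable_EFinP;
  exact: measurable_int intg.
apply/integrable12ltyP.
  apply/measurable_EFinP; apply: measurable_funM.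
    exact: measurableT_comp.
  exact: measurableT_comp.
have fing : (\int[m2]_y `|(g y)%:E| < +oo)%E by case/integrableP : intg.
have finf : (\int[m1]_y `|(f y)%:E| < +oo)%E by case/integrableP : intf.
have gE : (\int[m2]_y `|(g y)%:E| \is a fin_num)%E.
  by rewrite ge0_fin_numE//; apply: integral_ge0.
rewrite (eq_integral (fun x => `|(f x)%:E| * \int[m2]_y `|(g y)%:E|)%E).
  rewrite ge0_integralZr//.
  - by rewrite lte_mul_pinfty//; [apply: integral_ge0|rewrite ge0_fin_numE//;
      apply: integral_ge0].
  - by apply: measurableT_comp => //; apply/measurable_EFinP.
  - by apply: integral_ge0.
move=> x _; rewrite -ge0_integralZl//.
- by apply: eq_integral => y _; rewrite -abseM.
- by apply: measurableT_comp => //; apply/measurable_EFinP.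
Qed.

End fubini.

(** * Primitives of integrable functions *)

Lemma integrable_patch d (T : measurableType d) (R : realType)
    (mu : {measure set T -> \bar R}) (D : set T) (f : T -> R) : measurable D ->
  mu.-integrable D (EFin \o f) -> mu.-integrable setT (EFin \o f \_ D).
Proof.
move=> mD fi; rewrite -restrict_EFin; exact: (integrable_mkcond _ mD).1 fi.
Qed.

Section primitives.
Context {R : realType}.

(** The open interval only asks f to be defined on ]0, 1[, which is all that
    a control or a weak derivative provides. *)
Definition prim (f : R -> R) (s : R) : R := \int[leb]_(r in `]0, s[) f r.

Lemma prim0 (f : R -> R) : prim f 0 = 0.
Proof. by rewrite /prim set_itvoo0 Rintegral_set0. Qed.

Lemma within01_measurable (h : R -> R) :
  {within J01, continuous h} -> measurable_fun I01 h.
Proof.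
move=> hc; apply: (@measurable_funS _ _ _ _ J01) => //.
  exact: subset_itv_oo_cc.
exact: subspace_continuous_measurable_fun.
Qed.

Lemma within01_bounded (h : R -> R) :
  {within J01, continuous h} -> exists M, forall s, J01 s -> `|h s| <= M.
Proof.
move=> hc.
have /compact_bounded[M [_ Mh]] :=
  continuous_compact hc (@segment_compact _ 0 1).
exists (M + 1) => s Is; apply: Mh; last by exists s.
by rewrite ltrDl.
Qed.

Lemma within01_bounded_set (h : R -> R) :
  {within J01, continuous h} -> [bounded h s | s in I01].
Proof.
move=> /within01_bounded[M hM]; exists M; split; first exact: num_real.
move=> x Mx s Is; apply: le_trans (hM s _) (ltW Mx).
exact: subset_itv_oo_cc.
Qed.

Lemma within01_integrable (h : R -> R) :
  {within J01, continuous h} -> integrable01 h.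
Proof.
move=> hc; have := continuous_compact_integrable (@segment_compact _ 0 1) hc.
by apply: integrableS => //; exact: subset_itv_oo_cc.
Qed.

Lemma integrable_continuousM (f h : R -> R) : {within J01, continuous h} ->
  integrable01 f -> integrable01 (fun s => f s * h s).
Proof.
move=> hc fi.
have := integrableMl _ fi (within01_measurable hc) (within01_bounded_set hc).
by apply.
Qed.

Lemma subset_oo01 (T : R) : T <= 1 -> `]0, T[ `<=` I01.
Proof.
move=> T1 s /=; rewrite !in_itv /= => /andP[-> sT]; exact: lt_le_trans T1.
Qed.

Lemma integrable_oo (f : R -> R) (T : R) : T <= 1 -> integrable01 f ->
  leb.-integrable `]0, T[ (EFin \o f).
Proof. by move=> T1; apply: integrableS => //; exact: subset_oo01. Qed.

Lemma prim_continuous (f : R -> R) :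
  integrable01 f -> {within J01, continuous (prim f)}.
Proof.
move=> fi.
pose f' := f \_ I01.
have fi' : leb.-integrable `[0, 1] (EFin \o f').
  apply: (@integrableS _ _ _ _ setT) => //.
  exact: integrable_patch.
have := parameterized_integral_continuous ler01 fi'.
apply: subspace_eq_continuous => s; rewrite inE /= in_itv /= => /andP[s0 s1].
rewrite /from_subspace /= /parameterized_integral /prim.
rewrite -Rintegral_itv_obnd_cbnd; last first.
  apply: integrableS fi' => //.
  by move=> x /=; rewrite !in_itv/= => /andP[/ltW -> /le_trans ->].
rewrite -Rintegral_itv_bndo_bndc; last first.
  apply: integrableS fi' => //.
  by move=> x /=; rewrite !in_itv/= => /andP[/ltW -> /ltW/le_trans ->].
apply: eq_Rintegral => x; rewrite inE => xs; rewrite /f' patchE mem_set//.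
exact: subset_oo01 xs.
Qed.

Lemma eq_prim (f g : R -> R) (s : R) : s <= 1 ->
  (forall r, I01 r -> f r = g r) -> prim f s = prim g s.
Proof.
move=> s1 fg; apply: eq_Rintegral => r; rewrite inE => /(subset_oo01 s1);
  exact: fg.
Qed.

Lemma primD (f g : R -> R) (s : R) : s <= 1 -> integrable01 f ->
  integrable01 g ->
  prim (fun r => f r + g r) s = prim f s + prim g s.
Proof. by move=> s1 fi gi; apply: RintegralD => //; exact: integrable_oo. Qed.

Lemma primZ (f : R -> R) (a s : R) : s <= 1 -> integrable01 f ->
  prim (fun r => a * f r) s = a * prim f s.
Proof. by move=> s1 fi; apply: RintegralZl => //; exact: integrable_oo. Qed.

Lemma integrable01D (f g : R -> R) : integrable01 f -> integrable01 g ->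
  integrable01 (fun r => f r + g r).
Proof. by move=> fi gi; apply: eq_integrable (integrableD _ fi gi). Qed.

Lemma integrable01Z (f : R -> R) (a : R) : integrable01 f ->
  integrable01 (fun r => a * f r).
Proof. by move=> fi; apply: eq_integrable (integrableZl _ a fi). Qed.

Lemma within01_cst (a : R) : {within J01, continuous (cst a : R -> R)}.
Proof. by apply: continuous_subspaceT => s; exact: cvg_cst. Qed.

Lemma within01B (f g : R -> R) : {within J01, continuous f} ->
  {within J01, continuous g} -> {within J01, continuous (fun s => f s - g s)}.
Proof. by move=> fc gc s; apply: continuousB; [exact: fc|exact: gc]. Qed.

(** Both sides are iterated integrals of f r * g s over the triangle of the
    pairs r < s in ]0, T[. *)
Lemma prim_exchange (f g : R -> R) (T : R) : T <= 1 ->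
  integrable01 f -> integrable01 g ->
  prim (fun s => prim f s * g s) T =
  prim (fun r => f r * (prim g T - prim g r)) T.
Proof.
move=> T1 fi gi.
have fiT := integrable_oo T1 fi; have giT := integrable_oo T1 gi.
pose D := `]0, T[%classic : set R.
pose f' := f \_ D; pose g' := g \_ D.
(* k is the indicator function of the triangle. *)
pose k (x y : R) : R := (x < y)%R%:R.
have fi' : leb.-integrable setT (EFin \o f').
  by apply: integrable_patch; [exact: measurable_itv|exact: fiT].
have gi' : leb.-integrable setT (EFin \o g').
  by apply: integrable_patch; [exact: measurable_itv|exact: giT].
have f1E y : D y -> (fun x => f' x * k x y) = f \_ `]0, y[.
  rewrite /D /= in_itv /= => /andP[y0 yT]; apply/funext => x;
    rewrite /f' /k !patchE.
  case: ifPn; rewrite ?inE ?notin_setE /D /= !in_itv/=; last first.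
    move=> xT; case: ifPn; rewrite ?mul0r//= inE /= in_itv /= => /andP[x0 xy].
    by case: xT; rewrite x0 (lt_trans xy).
  move=> /andP[x0 xT].
  case: ifPn; rewrite ?inE ?notin_setE /= !in_itv/= x0 /=; first by move=> ->;
    rewrite mulr1.
  by move=> /negP/negbTE ->; rewrite mulr0.
have g1E x : D x -> (fun y => k x y * g' y) = g \_ `]x, T[.
  rewrite /D /= in_itv /= => /andP[x0 xT]; apply/funext => y;
    rewrite /g' /k !patchE.
  case: ifPn; rewrite ?inE ?notin_setE /D /= !in_itv/=; last first.
    move=> yT; case: ifPn; rewrite ?mulr0//= inE /= in_itv /= => /andP[xy yT'].
    by case: yT; rewrite yT' (lt_trans x0).
  move=> /andP[y0 yT].
  case: ifPn; rewrite ?inE ?notin_setE /= !in_itv/= yT /= andbT;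
    first by move=> ->; rewrite mul1r.
  by move=> /negP/negbTE ->; rewrite mul0r.
pose F x y := f' x * (k x y * g' y).
have FlE x : D x -> F x = (fun y => f x * (g \_ `]x, T[) y).
  move=> Dx; rewrite -(g1E _ Dx) /F; apply/funext => y.
  by rewrite /f' patchE mem_set.
have FrE y : D y -> F ^~ y = (fun x => (f \_ `]0, y[) x * g y).
  move=> Dy; rewrite -(f1E _ Dy) /F; apply/funext => x.
  have -> : g' y = g y by rewrite /g' patchE mem_set.
  by rewrite mulrA.
have Fl0 x : ~ D x -> F x = cst 0.
  by move=> nD; apply/funext => y; rewrite /F /f' patchE memNset// mul0r.
have Fr0 y : ~ D y -> F ^~ y = cst 0.
  by move=> nD; apply/funext => x; rewrite /F /g' patchE memNset// !mulr0.
have giP x : D x -> leb.-integrable setT (EFin \o g \_ `]x, T[).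
  move=> Dx; apply: integrable_patch; [exact: measurable_itv|move: Dx].
  rewrite /D /= in_itv /= => /andP[x0 _]; apply: integrableS giT => //.
  by move=> y /=; rewrite !in_itv /= => /andP[/(lt_trans x0) -> ->].
have fiP y : D y -> leb.-integrable setT (EFin \o f \_ `]0, y[).
  move=> Dy; apply: integrable_patch; [exact: measurable_itv|move: Dy].
  rewrite /D /= in_itv /= => /andP[_ yT]; apply: integrableS fiT => //.
  by move=> x /=; rewrite !in_itv /= => /andP[-> /lt_trans ->].
have ex : \int[leb]_x \int[leb]_y F x y = \int[leb]_y \int[leb]_x F x y.
  apply: Rintegral_exchange => [|x|y].
  - apply: le_integrable (integrable_prod fi' gi') => //=.
      apply/measurable_EFinP; rewrite /F.
      rewrite (_ : (fun _ => _) = fun z : R * R =>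
          if z.1 < z.2 then f' z.1 * g' z.2 else 0); last first.
        apply/funext => z; rewrite /k; case: (_ < _); first by rewrite mul1r.
        by rewrite mul0r mulr0.
      apply: measurable_fun_ifT => //; first exact: measurable_fun_ltr.
      apply: measurable_funM; apply: measurableT_comp => //.
        by apply/measurable_EFinP; exact: measurable_int fi'.
      by apply/measurable_EFinP; exact: measurable_int gi'.
    move=> z _; rewrite lee_fin /F /k !normrM; apply: ler_wpM2l => //.
    by case: (_ < _); rewrite ?normr1 ?normr0 ?mul1r ?mul0r.
  - case: (pselect (D x)) => Dx; last by rewrite Fl0//; exact: integrable0.
    rewrite FlE//.
    have := integrableZl (measurableT) (f x) (giP _ Dx).
    by apply: eq_integrable.
  - case: (pselect (D y)) => Dy; last by rewrite Fr0//; exact: integrable0.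
    rewrite FrE//.
    have := integrableZr (measurableT) (g y) (fiP _ Dy).
    by apply: eq_integrable.
have rE : \int[leb]_y \int[leb]_x F x y = prim (fun s => prim f s * g s) T.
  rewrite /prim [RHS]Rintegral_mkcond; apply: eq_Rintegral => y _.
  rewrite patchE; case: ifPn; rewrite ?inE ?notin_setE => Dy.
    by rewrite FrE// RintegralZr;
      [rewrite -Rintegral_mkcond|exact: measurableT|exact: fiP].
  by rewrite Fr0// /Rintegral /= integral0.
have lE : \int[leb]_x \int[leb]_y F x y =
    prim (fun s => f s * (prim g T - prim g s)) T.
  rewrite /prim [RHS]Rintegral_mkcond; apply: eq_Rintegral => x _.
  rewrite patchE; case: ifPn; rewrite ?inE ?notin_setE => Dx; last first.
    by rewrite Fl0// /Rintegral /= integral0.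
  rewrite FlE// RintegralZl; [|exact: measurableT|exact: giP].
  rewrite -Rintegral_mkcond; congr (_ * _).
  move: (Dx); rewrite /D /= in_itv /= => /andP[x0 xT].
  rewrite -(Rintegral_itvB giT); [|exact: ltW|exact: xT].
  rewrite -Rintegral_itv_bndo_bndc; first by [].
  apply: integrableS giT; [exact: measurable_itv|exact: measurable_itv|].
  by move=> z /=; rewrite !in_itv /= => /andP[-> /lt_trans ->].
by rewrite -rE -ex lE.
Qed.

Lemma prim_by_parts (f g : R -> R) (T : R) : T <= 1 ->
  integrable01 f -> integrable01 g ->
  prim (fun s => prim f s * g s) T + prim (fun s => f s * prim g s) T =
  prim f T * prim g T.
Proof.
move=> T1 fi gi; rewrite prim_exchange// -primD//; last 2 first.
- apply: integrable_continuousM => //; apply: within01B.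
    exact: within01_cst.
  exact: prim_continuous.
- by apply: integrable_continuousM => //; exact: prim_continuous.
by rewrite mulrC -primZ//; apply: eq_prim => // r _; ring.
Qed.

End primitives.

(** * Weak derivatives and square-integrable functions *)

Section weak_derivative.
Context {R : realType}.

Lemma prim_derive1 (phi : R -> R) (s : R) : 0 <= s ->
  (forall r, derivable phi r 1) -> continuous (derive1 phi) ->
  prim (derive1 phi) s = phi s - phi 0.
Proof.
rewrite le_eqVlt => /predU1P[<-|s0] dphi cphi; first by rewrite prim0 subrr.
have cphi' : {within `[0, s], continuous (derive1 phi)}.
  exact: continuous_subspaceT.
have ci := continuous_compact_integrable (@segment_compact _ 0 s) cphi'.
rewrite /prim Rintegral_itv_obnd_cbnd; last first.
  by apply: integrableS ci => // x /=;
    rewrite !in_itv/= => /andP[/ltW -> /ltW ->].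
rewrite Rintegral_itv_bndo_bndc; last first.
  by apply: integrableS ci => // x /=; rewrite !in_itv/= => /andP[-> /ltW ->].
rewrite /Rintegral (continuous_FTC2 s0 cphi' _ (fun _ _ => erefl))//.
have phic : continuous phi.
  by move=> x; apply: differentiable_continuous; apply/derivable1_diffP;
    exact: dphi.
split => //.
- by apply: cvg_at_right_filter; exact: phic.
- by apply: cvg_at_left_filter; exact: phic.
Qed.

Lemma prim1E (f : R -> R) : \int[leb]_(s in I01) f s = prim f 1.
Proof. by []. Qed.

Lemma test_function0 (phi : R -> R) : test_function phi ->
  phi 0 = 0 /\ phi 1 = 0.
Proof.
move=> [_ _ [a [b [a0 b1 out]]]]; split; apply: out.
  by rewrite (lt_geF a0).
by rewrite (lt_geF b1) andbF.
Qed.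

(** The boundary term of the integration by parts is prim g 1 * phi 1 = 0, and
    phi is the primitive of its derivative because phi 0 = 0. *)
Lemma prim_weak_derivative (g phi : R -> R) : integrable01 g ->
  test_function phi ->
  \int[leb]_(s in I01) (prim g s * derive1 phi s) =
  - \int[leb]_(s in I01) (g s * phi s).
Proof.
move=> gi tphi; have [phi0 phi1] := test_function0 tphi.
have [dphi cphi _] := tphi.
have := @prim_by_parts R g (derive1 phi) 1 (lexx 1) gi
  (within01_integrable (continuous_subspaceT cphi)).
rewrite (prim_derive1 ler01)// phi0 phi1 subrr mulr0 !prim1E => /eqP.
rewrite addr_eq0 => /eqP ->; congr (- _); apply: eq_prim => // r.
rewrite /= in_itv /= => /andP[/ltW r0 _].
by rewrite prim_derive1// phi0 subr0.
Qed.

(** A C^1 function with a kink in its derivative: its second differences are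
    the primitives of the hat functions. *)
Definition sq_pos (s : R) : R := Num.max 0 s ^+ 2.

Lemma is_derive_sq_pos (s : R) : is_derive s 1 sq_pos (2 * Num.max 0 s).
Proof.
(* This quadratic error bound holds at the kink s = 0 as well. *)
have bound h : `|sq_pos (s + h) - sq_pos s - h * (2 * Num.max 0 s)| <= h ^+ 2.
  rewrite /sq_pos ler_norml; case: (leP 0 s) => s0;
    case: (leP 0 (s + h)) => sh0;
  apply/andP; split; nra.
have Hcvg : h^-1 *: (sq_pos (h *: 1 + s) - sq_pos s) @[h --> 0^'] -->
    2 * Num.max 0 s.
  apply/cvgrPdist_le => /= e e0; near=> h.
  have h0 : h != 0 by near: h; exact: nbhs_dnbhs_neq.
  have he : `|h| <= e by near: h; exact: dnbhs0_le.
  rewrite -[h *: 1]/(h * 1) mulr1 -[_ *: _]/(_ * _) (addrC h).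
  rewrite distrC -(ler_pM2l (_ : 0 < `|h|)) ?normr_gt0// -normrM.
  rewrite mulrBr mulrA divff// mul1r (le_trans (bound h))//.
  by rewrite -real_normK ?num_real// expr2 ler_wpM2l.
by apply: DeriveDef; [apply: (cvgP (2 * Num.max 0 s))|apply: cvg_lim].
Unshelve. all: by end_near. Qed.

(** The tent of height 1 / e and integral 1 supported on [a - e, a + e]. *)
Definition hat (e a s : R) : R :=
  (Num.max 0 (s - a + e) - 2 * Num.max 0 (s - a) + Num.max 0 (s - a - e))
  / e ^+ 2.

(** Climbs from 0 to 1 across [a - e, a + e]. *)
Definition hat_prim (e a s : R) : R :=
  (sq_pos (s - a + e) - 2 * sq_pos (s - a) + sq_pos (s - a - e)) / (2 * e ^+ 2).

Lemma hat_ge0 (e a s : R) : 0 < e -> 0 <= hat e a s.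
Proof.
move=> e0; rewrite /hat divr_ge0 ?sqr_ge0//.
case: (leP 0 (s - a)); case: (leP 0 (s - a + e)); case: (leP 0 (s - a - e));
  lra.
Qed.

Lemma hat_out (e a s : R) : 0 < e -> e <= `|s - a| -> hat e a s = 0.
Proof.
move=> e0; rewrite /hat => es.
rewrite (_ : _ - _ + _ = 0) ?mul0r//; move: es.
rewrite ler_normr => /orP[|] es;
case: (leP 0 (s - a)); case: (leP 0 (s - a + e)); case: (leP 0 (s - a - e));
  lra.
Qed.

Lemma hat_prim_left (e a s : R) : 0 < e -> s <= a - e -> hat_prim e a s = 0.
Proof.
move=> e0 es; rewrite /hat_prim /sq_pos !(max_idPl _); lra.
Qed.

Lemma hat_prim_right (e a s : R) : 0 < e -> a + e <= s -> hat_prim e a s = 1.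
Proof.
move=> e0 es; rewrite /hat_prim /sq_pos !(max_idPr _); try lra.
by field; rewrite gt_eqF.
Qed.

Lemma is_derive_hat_prim (e a s : R) : 0 < e ->
  is_derive s 1 (hat_prim e a) (hat e a s).
Proof.
move=> e0.
pose f (k r : R) := sq_pos (r + k).
have d (k : R) : is_derive s 1 (f k) (2 * Num.max 0 (s + k)).
  have dk : is_derive s (1 : R) (fun r : R => r + k) 1.
    by apply: is_derive_affine => h; rewrite -(addrA _ s) addrK.
  have := @is_derive1_comp R sq_pos (fun r => r + k) s _ _
    (is_derive_sq_pos (s + k)) dk.
  by rewrite mulr1.
have -> : hat_prim e a =
    (2 * e ^+ 2)^-1 \*: (f (- a + e) - 2 \*: f (- a) + f (- a - e)).
  apply/funext => r; rewrite /hat_prim mulrC.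
  rewrite -[RHS]/((2 * e ^+ 2)^-1 *
    (f (- a + e) r - 2 * f (- a) r + f (- a - e) r)).
  by rewrite /f !(addrA r).
apply: is_derive_eq; rewrite /hat !addrA.
rewrite -![_ *: _]/(_ * _); field; rewrite gt_eqF//.
Qed.

Lemma hat_continuous (e a : R) : continuous (hat e a).
Proof.
have pos k : continuous (fun s : R => Num.max 0 (s - a + k)).
  move=> s; apply: (@continuous_max R R (cst 0) (fun s => s - a + k)).
    exact: cvg_cst.
  by apply: cvgD; [apply: cvgB; [exact: cvg_id|exact: cvg_cst]|exact: cvg_cst].
have pos0 : continuous (fun s : R => Num.max 0 (s - a)).
  rewrite (_ : (fun _ => _) = fun s => Num.max 0 (s - a + 0)); first exact: pos.
  by apply/funext => s; rewrite addr0.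
move=> s; apply: cvgM; last exact: cvg_cst.
apply: cvgD; last exact: pos.
by apply: cvgB; [exact: pos|apply: cvgM; [exact: cvg_cst|exact: pos0]].
Qed.

Lemma derive1_hat_prim (e a : R) : 0 < e -> derive1 (hat_prim e a) = hat e a.
Proof.
move=> e0; apply/funext => s; rewrite derive1E; apply: derive_val.
exact: is_derive_hat_prim.
Qed.

Lemma derivable_hat_prim (e a s : R) : 0 < e -> derivable (hat_prim e a) s 1.
Proof. by move=> e0; case: (is_derive_hat_prim a s e0). Qed.

(** The difference of two steps is a smoothed indicator function of [a, b],
    hence has compact support. *)
Lemma test_function_hat (e a b : R) : 0 < e -> e < a -> a <= b -> b < 1 - e ->
  test_function (hat_prim e a - hat_prim e b).
Proof.
move=> e0 ea ab b1.
have dE : derive1 (hat_prim e a - hat_prim e b) = hat e a - hat e b.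
  apply/funext => s; rewrite derive1E deriveB; try exact: derivable_hat_prim.
  by rewrite -!derive1E !derive1_hat_prim.
split.
- by move=> s; apply: derivableB; exact: derivable_hat_prim.
- by rewrite dE => s; apply: cvgB; exact: hat_continuous.
exists (a - e), (b + e); split; [lra|lra|move=> s sab].
rewrite -[LHS]/(hat_prim e a s - hat_prim e b s); have [sa|sa] := leP s (a - e).
  have sb : s <= b - e by lra.
  by rewrite !hat_prim_left// subrr.
have [sb|sb] := leP s (b + e).
  by case: sab; rewrite (ltW sa) sb.
have sa' : a + e <= s by lra.
by rewrite !hat_prim_right ?subrr//; exact: ltW.
Qed.

Lemma integral_hat (e a : R) : 0 < e -> e <= a -> a <= 1 - e ->
  \int[leb]_(s in I01) hat e a s = 1.
Proof.
move=> e0 ea a1; rewrite prim1E -derive1_hat_prim// prim_derive1//.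
- by rewrite hat_prim_right ?hat_prim_left ?subr0//; lra.
- by move=> r; exact: derivable_hat_prim.
- by rewrite derive1_hat_prim//; exact: hat_continuous.
Qed.

Lemma hat_concentrates (h : R -> R) (a eta : R) : {within J01, continuous h} ->
  0 < a < 1 -> 0 < eta ->
  exists2 d, 0 < d & forall e, 0 < e < d ->
    `|\int[leb]_(s in I01) (h s * hat e a s) - h a| <= eta.
Proof.
move=> hc /andP[a0 a1] eta0.
have ha : h s @[s --> a] --> h a.
  have /(continuous_within_itvP _ ltr01)[+ _ _] := hc.
  by apply; rewrite in_itv /= a0.
have [d /= d0 hd] := (cvgrPdist_le _ _).1 ha _ eta0.
exists (Num.min d (Num.min a (1 - a))).
  by rewrite !lt_min d0 a0 subr_gt0.
move=> e /andP[e0]; rewrite !lt_min => /and3P[ed ea e1].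
have hatc : {within J01, continuous (hat e a)}.
  by apply: continuous_subspaceT; exact: hat_continuous.
have hati := within01_integrable hatc.
have ihat : \int[leb]_(s in I01) hat e a s = 1 by apply: integral_hat => //;
  lra.
have intf := integrable_continuousM hatc (within01_integrable hc).
have intc : integrable01 (fun s => h a * hat e a s) by exact: integrable01Z.
have cE (c : R) : \int[leb]_(s in I01) (c * hat e a s) = c.
  by rewrite RintegralZl// ihat mulr1.
rewrite -[X in _ - X]cE -RintegralB//.
have intd : integrable01 (fun s => h s * hat e a s - h a * hat e a s).
  by apply: eq_integrable (integrableB _ intf intc).
apply: le_trans (le_normr_Rintegral _ intd) _ => //.
rewrite -[leRHS]cE.
apply: le_Rintegral => //.
- exact: integrable_norm.
- exact: integrable01Z.
move=> s _; rewrite -mulrBl normrM (ger0_norm (hat_ge0 _ _ e0)).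
have [se|se] := leP e `|s - a|; first by rewrite hat_out// !mulr0.
apply: ler_wpM2r; first exact: hat_ge0.
rewrite distrC; apply: hd => /=; rewrite distrC; exact: lt_trans ed.
Qed.

(** The lemma of du Bois-Reymond.  Tested against the difference of the steps at
    a and b, the hypothesis says that h has the same average against the hats at
    a and b; letting the hats shrink gives h a = h b. *)
Lemma du_Bois_Reymond (h : R -> R) : {within J01, continuous h} ->
  (forall phi, test_function phi ->
     \int[leb]_(s in I01) (h s * derive1 phi s) = 0) ->
  forall s, J01 s -> h s = h 0.
Proof.
move=> hc weak0.
have eq_oo a b : 0 < a -> a <= b -> b < 1 -> h a = h b.
  move=> a0 ab b1; apply/eqP; rewrite -subr_eq0 -normr_le0.
  apply/ler_addgt0Pr => eta eta0; rewrite add0r.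
  have eta20 : 0 < eta / 2 by lra.
  have aI : 0 < a < 1 by rewrite a0 (le_lt_trans ab).
  have bI : 0 < b < 1 by rewrite b1 (lt_le_trans a0).
  have [da da0 Ha] := hat_concentrates hc aI eta20.
  have [db db0 Hb] := hat_concentrates hc bI eta20.
  pose e := Num.min (Num.min da db) (Num.min a (1 - b)) / 2.
  have : 0 < Num.min (Num.min da db) (Num.min a (1 - b)).
    by rewrite !lt_min da0 db0 a0 subr_gt0.
  have : e * 2 <= Num.min (Num.min da db) (Num.min a (1 - b)).
    by rewrite /e mulfVK.
  rewrite !le_min => /andP[/andP[eda edb] /andP[ea eb]] e0'.
  have e0 : 0 < e by rewrite /e divr_gt0.
  have {}Ha := Ha e; have {}Hb := Hb e.
  have tphi : test_function (hat_prim e a - hat_prim e b).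
    by apply: test_function_hat => //; lra.
  have hatc c : {within J01, continuous (hat e c)}.
    by apply: continuous_subspaceT; exact: hat_continuous.
  have hi c := integrable_continuousM (hatc c) (within01_integrable hc).
  have := weak0 _ tphi.
  rewrite (_ : derive1 _ = hat e a - hat e b); last first.
    apply/funext => s; rewrite derive1E deriveB; try exact: derivable_hat_prim.
    by rewrite -!derive1E !derive1_hat_prim.
  rewrite (_ : \int[leb]_(s in I01) _ = \int[leb]_(s in I01) (h s * hat e a s) -
     \int[leb]_(s in I01) (h s * hat e b s)); last first.
    by rewrite -RintegralB//; apply: eq_Rintegral => s _; rewrite -mulrBr.
  move=> /eqP; rewrite subr_eq0 => /eqP Iab.
  move: Ha Hb; rewrite -Iab; set I := \int[_]_(_ in _) _ => Ha Hb.
  have {}Ha : `|I - h a| <= eta / 2 by apply: Ha; lra.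
  have {}Hb : `|I - h b| <= eta / 2 by apply: Hb; lra.
  move: Ha Hb; rewrite !ler_norml; lra.
have half s : 0 < s -> s < 1 -> h s = h (1 / 2).
  move=> s0 s1; have [sh|sh] := leP s (1 / 2).
    by apply: eq_oo => //; lra.
  by apply/esym/eq_oo; lra.
have /(continuous_within_itvP _ ltr01)[_ h0 h1] := hc.
have h0E : h 0 = h (1 / 2).
  apply: (cvg_unique _ h0) => //; apply: cvg_near_cst.
  near=> s; apply: half; first by near: s; exact: nbhs_right_gt.
  by near: s; apply: nbhs_right_lt; exact: ltr01.
have h1E : h 1 = h (1 / 2).
  apply: (cvg_unique _ h1) => //; apply: cvg_near_cst.
  near=> s; apply: half; last by near: s; exact: nbhs_left_lt.
  by near: s; apply: nbhs_left_gt; exact: ltr01.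
move=> s /=; rewrite in_itv /= h0E => /andP[].
rewrite le_eqVlt => /predU1P[<- _|s0]; first exact: h0E.
rewrite le_eqVlt => /predU1P[->|s1]; first exact: h1E.
exact: half.
Unshelve. all: by end_near. Qed.

(** Square integrability in terms of real-valued integrability. *)
Lemma L2P (f : R -> R) :
  L2 f <-> measurable_fun I01 f /\ integrable01 (fun s => f s ^+ 2).
Proof.
split=> -[mf f2]; split=> //.
  apply/integrableP; split; first by apply/measurable_EFinP;
    exact: measurable_funX.
  by under eq_integral do rewrite /= ger0_norm ?sqr_ge0//.
case/integrableP : f2 => _.
by under eq_integral do rewrite /= ger0_norm ?sqr_ge0//.
Qed.

Lemma within01_L2 (f : R -> R) : {within J01, continuous f} -> L2 f.
Proof.
move=> fc; apply/L2P; split; first exact: within01_measurable.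
exact: integrable_continuousM (within01_integrable fc).
Qed.

Lemma L2M_integrable (f g : R -> R) : L2 f -> L2 g ->
  integrable01 (fun s => f s * g s).
Proof.
move=> /L2P[mf f2] /L2P[mg g2].
apply: le_integrable (integrable01D f2 g2) => //.
  by apply/measurable_EFinP; exact: measurable_funM.
move=> s _; rewrite lee_fin [leRHS]ger0_norm ?addr_ge0 ?sqr_ge0// normrM.
rewrite -(real_normK (num_real (f s))) -(real_normK (num_real (g s))).
have := sqr_ge0 (`|f s| - `|g s|); have := sqr_ge0 (`|f s| + `|g s|); nra.
Qed.

Lemma L2_integrable (f : R -> R) : L2 f -> integrable01 f.
Proof.
move=> Lf; have := L2M_integrable Lf (within01_L2 (@within01_cst R 1)).
by apply: eq_integrable => // s _; rewrite /= mulr1.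
Qed.

Lemma L2D (f g : R -> R) : L2 f -> L2 g -> L2 (fun s => f s + g s).
Proof.
move=> Lf Lg; have fg := L2M_integrable Lf Lg.
have [[mf f2] [mg g2]] := ((L2P f).1 Lf, (L2P g).1 Lg).
apply/L2P; split; first exact: measurable_funD.
have := integrable01D (integrable01D f2 g2) (integrable01Z 2 fg).
by apply: eq_integrable => // s _ /=; congr EFin; ring.
Qed.

Lemma L2_continuousM (f h : R -> R) : {within J01, continuous h} -> L2 f ->
  L2 (fun s => f s * h s).
Proof.
move=> hc /L2P[mf f2]; apply/L2P; split.
  by apply: measurable_funM => //; exact: within01_measurable.
have := integrable_continuousM hc (integrable_continuousM hc f2).
by apply: eq_integrable => // s _ /=; congr EFin; ring.
Qed.

Lemma L2Z (f : R -> R) (a : R) : L2 f -> L2 (fun s => a * f s).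
Proof.
move=> Lf; have := L2_continuousM (@within01_cst R a) Lf.
by congr L2; apply/funext => s; rewrite mulrC.
Qed.

Lemma W12_of_prim (g : R -> R) : L2 g -> W12 (prim g) g.
Proof.
move=> Lg; have gi := L2_integrable Lg; split=> //.
  by apply: within01_L2; exact: prim_continuous.
by move=> phi; exact: prim_weak_derivative.
Qed.

(** f - prim g is continuous with weak derivative 0, hence constant. *)
Lemma W12_prim (f g : R -> R) : {within J01, continuous f} -> W12 f g ->
  forall s, J01 s -> f s = f 0 + prim g s.
Proof.
move=> fc [_ /L2_integrable gi weak] s Is.
have pc := prim_continuous gi.
suff : f s - prim g s = f 0 - prim g 0.
  by rewrite prim0 subr0 => <-; rewrite subrK.
apply: (du_Bois_Reymond (within01B fc pc)) Is => phi tphi.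
have dphic : {within J01, continuous (derive1 phi)}.
  by apply: continuous_subspaceT; case: tphi.
have := weak _ tphi; rewrite -(prim_weak_derivative gi tphi) => e.
have if1 := integrable_continuousM dphic (within01_integrable fc).
have if2 := integrable_continuousM dphic (within01_integrable pc).
transitivity (\int[leb]_(s in I01) (f s * derive1 phi s) -
              \int[leb]_(s in I01) (prim g s * derive1 phi s)).
  by rewrite -RintegralB//; apply: eq_Rintegral => r _; rewrite mulrBl.
by rewrite e subrr.
Qed.

End weak_derivative.

(** * Horizontal paths and their controls *)

(** Monotonicity of the almost-everywhere quantifier. *)
Lemma ae_imp (R : realType) (P Q : R -> Prop) : (forall x, P x -> Q x) ->
  {ae @lebesgue_measure R, forall x, P x} ->
    {ae @lebesgue_measure R, forall x, Q x}.
Proof.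
move=> PQ [N [mN N0 PN]]; exists N; split=> // x nQ; apply: PN => /= Px.
exact/nQ/PQ.
Qed.

Section horizontal_lifts.
Context {R : realType} {m : nat}.
Notation G := (free_carnot R m).

Lemma wedgeE (k : 'I_(wedge_dim m)) :
  exists i j : 'I_m, forall x y : 'rV[R]_m,
    wedge x y 0 k = x 0 i * y 0 j - x 0 j * y 0 i.
Proof.
exists (val (enum_val k)).1, (val (enum_val k)).2 => x y.
by rewrite mxE; case: (val _).
Qed.

Lemma within_row n (f : 'I_n -> R -> R) :
  (forall i, {within J01, continuous (f i)}) ->
  {within J01, continuous (fun s => \row_i f i s)}.
Proof.
move=> fc x; apply/cvgrPdist_le => /= e e0; near=> s.
rewrite /Num.Def.normr/= mx_normrE (bigmax_le _ (ltW e0))//= => -[i j] _.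
rewrite !mxE/=; move: j {i}; near: s; apply: filter_forall => /= j.
exact: ((cvgrPdist_le _ _).1 (fc j x)).
Unshelve. all: by end_near. Qed.

Definition position (u : R -> 'rV[R]_m) (s : R) : 'rV[R]_m :=
  \row_i prim (fun r => u r 0 i) s.

(** The horizontal path from the origin with control u: the second component
    integrates the vertical velocity (1/2) x wedge u. *)
Definition hlift (u : R -> 'rV[R]_m) (s : R) : G :=
  (position u s,
   \row_k prim (fun r => (2^-1 *: wedge (position u r) (u r)) 0 k) s).

Lemma position_continuous (u : R -> 'rV[R]_m) i : L2v u ->
  {within J01, continuous (fun s => position u s 0 i)}.
Proof.
move=> Lu; rewrite (_ : (fun _ => _) = prim (fun r => u r 0 i)).
  exact: prim_continuous (L2_integrable (Lu i)).
by apply/funext => s; rewrite mxE.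
Qed.

(** The vertical velocity along a continuous path is square-integrable, its
    components being combinations of products of a bounded and an L^2 function.
      *)
Lemma L2_wedge (x u : R -> 'rV[R]_m) k : L2v u ->
  (forall i, {within J01, continuous (fun s => x s 0 i)}) ->
  L2 (fun s => (2^-1 *: wedge (x s) (u s)) 0 k).
Proof.
move=> Lu xc; have [i [j kE]] := wedgeE k.
have := L2Z 2^-1 (L2D (L2_continuousM (xc i) (Lu j))
  (L2Z (-1) (L2_continuousM (xc j) (Lu i)))).
by congr L2; apply/funext => s; rewrite mxE kE; ring.
Qed.

Lemma horizontal_hlift (u : R -> 'rV[R]_m) : L2v u -> horizontal (hlift u) u.
Proof.
move=> Lu; split=> //.
have L2k k := L2_wedge k Lu (fun i => @position_continuous u i Lu).
exists (fun s => (u s, 2^-1 *: wedge (position u s) (u s))).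
  split.
  - have h1 := within_row (fun i => prim_continuous (L2_integrable (Lu i))).
    have h2 := within_row (fun k => prim_continuous (L2_integrable (L2k k))).
    by move=> s; exact: (cvg_pair (h1 s) (h2 s)).
  - move=> i; have := W12_of_prim (Lu i).
    by congr W12; apply/funext => s; rewrite mxE.
  - move=> k; have := W12_of_prim (L2k k).
    by congr W12; apply/funext => s; rewrite mxE.
by apply: aeW => s _; rewrite -[RHS]/(hfield (u s) (hlift u s)) hfieldE.
Qed.

Lemma hlift0 (u : R -> 'rV[R]_m) : hlift u 0 = 0.
Proof.
by congr pair; apply/rowP => i; rewrite !mxE prim0.
Qed.

Lemma ae_prim (f g : R -> R) (s : R) : s <= 1 ->
  measurable_fun I01 f -> measurable_fun I01 g ->
  {ae leb, forall r, I01 r -> f r = g r} -> prim f s = prim g s.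
Proof.
move=> s1 mf mg fg; congr fine.
have sub := subset_oo01 s1.
apply: ae_eq_integral => //.
- by apply/measurable_EFinP; apply: measurable_funS mf.
- by apply/measurable_EFinP; apply: measurable_funS mg.
by apply: ae_imp fg => r fgr /sub/fgr /= ->.
Qed.

(** A horizontal path is determined by its control and its starting point: its
    projection is the primitive of u, which determines the vertical velocity and
    then the vertical component. *)
Lemma horizontal_endpoint (c : R -> G) (u : R -> 'rV[R]_m) :
  horizontal c u -> c 0 = 0 -> c 1 = hlift u 1.
Proof.
move=> [Lu [dc [cc W1 W2] dcE]] c0.
have c1c i : {within J01, continuous (fun s => (c s).1 0 i)}.
  move=> s; apply: (@cvg_comp _ _ _ c (fun q : G => q.1 0 i) _ _ _ (cc s)).
  apply: (@continuous_comp G 'rV[R]_m R fst (fun M => M 0 i)).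
    exact: cvg_fst.
  exact: coord_continuous.
have c2c k : {within J01, continuous (fun s => (c s).2 0 k)}.
  move=> s; apply: (@cvg_comp _ _ _ c (fun q : G => q.2 0 k) _ _ _ (cc s)).
  apply: (@continuous_comp G 'rV[R]_(wedge_dim m) R snd (fun M => M 0 k)).
    exact: cvg_snd.
  exact: coord_continuous.
have c1E s : J01 s -> (c s).1 = position u s.
  move=> Is; apply/rowP => i;
    rewrite mxE (W12_prim (c1c i) (W1 i) Is) c0 mxE add0r.
  have s1 : s <= 1 by move: Is; rewrite /= in_itv /= => /andP[].
  case: (W1 i) => _ [md _] _; case: (Lu i) => mu _.
  apply: ae_prim => //; apply: ae_imp dcE => r dcr /dcr ->.
  by rewrite -[\sum_j _]/(hfield _ _) hfieldE.
have I1 : J01 (1 : R) by rewrite /= in_itv /= ler01 lexx.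
rewrite [LHS]surjective_pairing; congr pair; first exact: c1E.
apply/rowP => k; rewrite mxE (W12_prim (c2c k) (W2 k) I1) c0 mxE add0r.
case: (W2 k) => _ [md _] _; have [mw _] := L2_wedge k Lu c1c.
transitivity (prim (fun r => (2^-1 *: wedge (c r).1 (u r)) 0 k) 1).
  apply: ae_prim => //; apply: ae_imp dcE => r dcr /dcr ->.
  by rewrite -[\sum_j _]/(hfield _ _) hfieldE.
apply: eq_prim => // r Ir; rewrite c1E//.
exact: subset_itv_oo_cc Ir.
Qed.

Lemma L2v_perturb (u : R -> 'rV[R]_m) (psi : R -> R) (y : 'rV[R]_m) :
  L2v u -> L2 psi -> L2v (fun s => u s + psi s *: y).
Proof.
move=> Lu Lpsi i; have := L2D (Lu i) (L2Z (y 0 i) Lpsi).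
by congr L2; apply/funext => s; rewrite !mxE mulrC.
Qed.

(** The vertical component in terms of the integrals of x_i u_j, in which the
    perturbation of the control is bilinear. *)
Lemma hlift_area (v : R -> 'rV[R]_m) (k : 'I_(wedge_dim m)) (i j : 'I_m) :
  L2v v ->
  (forall x y : 'rV[R]_m, wedge x y 0 k = x 0 i * y 0 j - x 0 j * y 0 i) ->
  (hlift v 1).2 0 k = 2^-1 * (prim (fun s => v s 0 j * position v s 0 i) 1 -
                             prim (fun s => v s 0 i * position v s 0 j) 1).
Proof.
move=> Lv kE; rewrite mxE -mulN1r.
have ij a b := integrable_continuousM (@position_continuous v a Lv)
  (L2_integrable (Lv b)).
rewrite -primZ// -primD//; last exact: integrable01Z.
rewrite -primZ//; last by apply: integrable01D => //; exact: integrable01Z.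
by apply: eq_prim => // r _; rewrite mxE kE; ring.
Qed.

(** With Psi the primitive of psi, the perturbed projection is x + Psi y.  In
    the integral of (x_i + Psi y_i) (u_j + psi y_j), the conditions on psi give
    int x_i psi = x_i(1) and, by parts, int Psi u_j = x_j(1) - int psi x_j = 0;
    the term y_i y_j int Psi psi is symmetric in i and j and disappears from
    the wedge. *)
Lemma hlift_perturb (u : R -> 'rV[R]_m) (psi : R -> R) (y : 'rV[R]_m) :
  L2v u -> L2 psi -> prim psi 1 = 1 ->
  (forall i, prim (fun s => psi s * position u s 0 i) 1 = position u 1 0 i) ->
  hlift (fun s => u s + psi s *: y) 1 = hexp y (hlift u 1).
Proof.
move=> Lu Lpsi psi1 psix; rewrite hexpE.
have psii := L2_integrable Lpsi.
have ui i := L2_integrable (Lu i).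
pose x i s := position u s 0 i.
have posE s i : s <= 1 ->
    position (fun s => u s + psi s *: y) s 0 i = x i s + y 0 i * prim psi s.
  move=> s1; rewrite /x !mxE -primZ// -primD//; last exact: integrable01Z.
  by apply: eq_prim => // r _; rewrite !mxE mulrC.
have xc i : {within J01, continuous (x i)} by exact: position_continuous.
have pc := prim_continuous psii.
have lt1 r : I01 r -> r <= 1 by rewrite /= in_itv /= => /andP[_ /ltW].
have area i j :
    prim (fun s => (u s + psi s *: y) 0 j *
                   position (fun s => u s + psi s *: y) s 0 i) 1 =
    prim (fun s => u s 0 j * position u s 0 i) 1 +
    (y 0 j * position u 1 0 i +
     y 0 i * y 0 j * prim (fun s => psi s * prim psi s) 1).
  have Psiu : prim (fun s => u s 0 j * prim psi s) 1 = 0.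
    have := prim_by_parts (lexx 1) psii (ui j).
    rewrite psi1 mul1r.
    have -> : prim (fun s => psi s * prim (fun s0 => u s0 0 j) s) 1 =
              prim (fun s0 => u s0 0 j) 1.
      transitivity (position u 1 0 j); last by rewrite mxE.
      by rewrite -psix; apply: eq_prim => // r _; rewrite mxE.
    move=> /(canRL (addrK _)); rewrite subrr => <-.
    by apply: eq_prim => // r _; rewrite mulrC.
  have i1 := integrable_continuousM (xc i) (ui j).
  have i2 := integrable01Z (y 0 j) (integrable_continuousM (xc i) psii).
  have i3 := integrable01Z (y 0 i) (integrable_continuousM pc (ui j)).
  have i4 := integrable01Z (y 0 i * y 0 j) (integrable_continuousM pc psii).
  transitivity (prim (fun s => u s 0 j * x i s + (y 0 j * (psi s * x i s) +
      (y 0 i * (u s 0 j * prim psi s) + y 0 i * y 0 j * (psi s * prim psi s))))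
        1).
    apply: eq_prim => // r /lt1 r1; rewrite posE// !mxE; ring.
  rewrite (primD _ i1)//; last by apply: integrable01D => //;
    exact: integrable01D.
  rewrite (primD _ i2)//; last exact: integrable01D.
  rewrite (primD _ i3)//.
  rewrite !primZ//; try exact: integrable_continuousM.
  by rewrite Psiu mulr0 add0r psix.
rewrite [LHS]surjective_pairing; congr pair.
  by apply/rowP => i; rewrite posE// psi1 mulr1 [RHS]mxE.
apply/rowP => k; have [i [j kE]] := wedgeE k.
transitivity ((hlift u 1).2 0 k + 2^-1 * wedge (position u 1) y 0 k).
  rewrite (hlift_area (L2v_perturb y Lu Lpsi) kE) !area kE (hlift_area Lu kE);
    ring.
by rewrite [RHS]mxE; congr (_ + _); rewrite [RHS]mxE.
Qed.

End horizontal_lifts.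

(** * Moment problems *)

Section weights.
Context {R : realType}.

Lemma prim_sum n (F : 'I_n -> R -> R) (s : R) : s <= 1 ->
  (forall i, integrable01 (F i)) ->
  integrable01 (fun r => \sum_i F i r) /\
  prim (fun r => \sum_i F i r) s = \sum_i prim (F i) s.
Proof.
move=> s1; elim: n F => [F _|n IHn F Fi].
  rewrite big_ord0 (_ : (fun _ => _) = cst 0); last first.
    by apply/funext => r; rewrite big_ord0.
  split; first by apply: within01_integrable; exact: within01_cst.
  by rewrite /prim /Rintegral /= integral0.
have [ih1 ih2] := IHn _ (fun i => Fi (widen_ord (leqnSn n) i)).
rewrite (_ : (fun _ => _) = fun r =>
  \sum_(i < n) F (widen_ord (leqnSn n) i) r + F ord_max r).
  by split; [exact: integrable01D|rewrite big_ord_recr primD//= ih2].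
by apply/funext => r; rewrite big_ord_recr.
Qed.

Lemma within01_sum n (F : 'I_n -> R -> R) :
  (forall i, {within J01, continuous (F i)}) ->
  {within J01, continuous (fun s => \sum_i F i s)}.
Proof.
elim: n F => [F _|n IHn F Fc].
  rewrite (_ : (fun _ => _) = cst 0); first exact: within01_cst.
  by apply/funext => r; rewrite big_ord0.
rewrite (_ : (fun _ => _) = fun r =>
  \sum_(i < n) F (widen_ord (leqnSn n) i) r + F ord_max r).
  by move=> s; apply: continuousD; [apply: IHn => i; exact: Fc|exact: Fc].
by apply/funext => r; rewrite big_ord_recr.
Qed.

Lemma within01M (f g : R -> R) : {within J01, continuous f} ->
  {within J01, continuous g} -> {within J01, continuous (fun s => f s * g s)}.
Proof. by move=> fc gc s; apply: continuousM; [exact: fc|exact: gc]. Qed.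

(** A symmetric linear system is solvable when its right-hand side is orthogonal
    to the kernel of its matrix.  Here the matrix is the Gram matrix of the f_k
    in L^2(w ds), and a vector a of its kernel makes the integral of
    w (sum_k a_k f_k)^2 vanish. *)
Lemma moment_problem n (f : 'I_n -> R -> R) (w : R -> R) (b : 'I_n -> R) :
  (forall k, {within J01, continuous (f k)}) -> integrable01 w ->
  (forall a : 'I_n -> R,
    prim (fun s => w s * (\sum_k a k * f k s) ^+ 2) 1 = 0 ->
    \sum_k a k * b k = 0) ->
  exists l : 'I_n -> R,
    forall k, prim (fun s => w s * (\sum_j l j * f j s) * f k s) 1 = b k.
Proof.
move=> fc wi compat.
have wff i j : integrable01 (fun s => w s * (f i s * f j s)).
  by apply: integrable_continuousM => //; exact: within01M.
pose Gr : 'M[R]_n := \matrix_(i, j) prim (fun s => w s * (f i s * f j s)) 1.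
have GrE (a : 'I_n -> R) k :
    prim (fun s => w s * (\sum_j a j * f j s) * f k s) 1 = \sum_j a j * Gr j k.
  transitivity (prim (fun s => \sum_j a j * (w s * (f j s * f k s))) 1).
    apply: eq_prim => // r _; rewrite mulr_sumr mulr_suml;
      apply: eq_bigr => j _; ring.
  rewrite (prim_sum (lexx 1) _).2 => [|i]; last exact: integrable01Z.
  by apply: eq_bigr => j _; rewrite primZ// mxE.
pose B : 'rV[R]_n := \row_k b k.
have : (B <= Gr)%MS.
  rewrite submxE; apply/eqP/rowP => c; rewrite !mxE.
  (* The columns of cokermx Gr span the kernel of Gr. *)
  pose a k := cokermx Gr k c.
  under eq_bigr do rewrite mxE mulrC; apply: (compat a).
  have sc : {within J01, continuous (fun s => \sum_j a j * f j s)}.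
    by apply: within01_sum => j; apply: within01M => //; exact: within01_cst.
  transitivity (prim (fun s =>
    \sum_k a k * (w s * (\sum_j a j * f j s) * f k s)) 1).
    apply: eq_prim => // r _; rewrite expr2 mulrA [in LHS]mulr_sumr.
    by apply: eq_bigr => j _; ring.
  have wsf k : integrable01 (fun s => w s * (\sum_j a j * f j s) * f k s).
    by do 2 apply: integrable_continuousM => //.
  rewrite (prim_sum (lexx 1) _).2 => [|i]; last exact: integrable01Z.
  under eq_bigr do rewrite primZ// GrE.
  under eq_bigr do rewrite mulr_sumr.
  rewrite exchange_big big1//= => j _.
  transitivity (a j * (Gr *m cokermx Gr) j c);
    last by rewrite mulmx_coker mxE mulr0.
  by rewrite mxE mulr_sumr; apply: eq_bigr => k _; rewrite /a; ring.
move=> /submxP[D BD]; exists (fun j => D 0 j) => k; rewrite GrE.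
by move/rowP: BD => /(_ k); rewrite !mxE => ->.
Qed.

(** Integration by parts expresses prim g T ^+ 2 as twice the integral of
    g * prim g; as (c + prim g) * g vanishes almost everywhere,
    this is - 2 * c * prim g T. *)
Lemma prim_square_cst (g : R -> R) (c T : R) : T <= 1 -> integrable01 g ->
  {ae leb, forall s, I01 s -> (c + prim g s) * g s = 0} ->
  (c + prim g T) ^+ 2 = c ^+ 2.
Proof.
move=> T1 gi gg0.
have pc := prim_continuous gi.
have cpc : {within J01, continuous (fun s => c + prim g s)}.
  by move=> s; apply: continuousD; [exact: within01_cst|exact: pc].
have mul0 : prim (fun s => g s * (c + prim g s)) T = 0.
  have -> : 0 = prim (cst 0) T by rewrite /prim /Rintegral /= integral0.
  apply: ae_prim => //; last by apply: ae_imp gg0 => s gs /gs; rewrite mulrC.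
  by apply/measurable_EFinP;
    exact: measurable_int (integrable_continuousM cpc gi).
have := prim_by_parts T1 gi gi.
have e : prim (fun s => g s * prim g s) T = - (c * prim g T).
  apply/eqP; rewrite -addr_eq0 -primZ// -primD//; last 2 first.
  - exact: integrable_continuousM.
  - exact: integrable01Z.
  by rewrite -mul0; apply/eqP/eq_prim => // r _; ring.
rewrite e (_ : prim _ T = - (c * prim g T)); first by move=> ?; nra.
by rewrite -e; apply: eq_prim => // r _; rewrite mulrC.
Qed.

Lemma prim_eq0_ae (f : R -> R) : integrable01 f ->
  (forall s, I01 s -> 0 <= f s) ->
  prim f 1 = 0 -> {ae leb, forall s, I01 s -> f s = 0}.
Proof.
move=> fi f0 pf.
have mf : measurable_fun I01 (EFin \o f) := measurable_int _ fi.
have ff : (\int[leb]_(s in I01) (f s)%:E \is a fin_num)%E.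
  exact: integrable_fin_num fi.
have If : (\int[leb]_(s in I01) `|(f s)%:E| = 0)%E.
  transitivity (\int[leb]_(s in I01) (f s)%:E)%E.
    by apply: eq_integral => s; rewrite inE => Is;
      rewrite gee0_abs// lee_fin f0.
  by rewrite -(fineK ff) -[fine _]/(prim f 1) pf.
have mI : measurable (I01 : set (measurableTypeR R)) by exact: measurable_itv.
have := (ae_eq_integral_abs leb mI mf).1 If.
by apply: ae_imp => s fs /fs [].
Qed.

End weights.

(** * Euclidean norms and lengths *)

Section enorms.
Context {R : realType}.

Lemma enorm_sq n (v : 'rV[R]_n) : enorm v ^+ 2 = \sum_i v 0 i ^+ 2.
Proof. by rewrite sqr_sqrtr// sumr_ge0// => i _; exact: sqr_ge0. Qed.

Lemma enorm_ge0 n (v : 'rV[R]_n) : 0 <= enorm v.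
Proof. exact: sqrtr_ge0. Qed.

Lemma enorm_eq0 n (v : 'rV[R]_n) : enorm v = 0 -> v = 0.
Proof.
move=> v0; have := enorm_sq v; rewrite v0 expr0n /= => /esym/eqP.
rewrite psumr_eq0 => [/allP h|i _]; last exact: sqr_ge0.
apply/rowP => i; rewrite mxE; apply/eqP; rewrite -sqrf_eq0.
by apply: h; rewrite mem_index_enum.
Qed.

Lemma L2_enorm n (u : R -> 'rV[R]_n) : L2v u -> L2 (fun s => enorm (u s)).
Proof.
move=> Lu.
have [S _] := prim_sum (lexx 1) (fun i => ((L2P _).1 (Lu i)).2).
apply/L2P; split.
  have mS : measurable_fun I01 (fun s => \sum_i u s 0 i ^+ 2).
    by apply/measurable_EFinP; exact: measurable_int S.
  exact: measurableT_comp (continuous_measurable_fun (@sqrt_continuous R)) mS.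
by apply: eq_integrable S => // s _ /=; rewrite enorm_sq.
Qed.

(** With c, A, B the three norms, the parallelogram identity gives
    (A + B)^2 <= 2 (A^2 + B^2) = 4 c^2 (1 + q) <= (2 c + c q)^2 for
    q = t^2 |y|^2.  As the perturbation is proportional to |a|, no division by
    |a| occurs and a = 0 is allowed. *)
Lemma enorm_second_difference n (a y : 'rV[R]_n) (t : R) :
  enorm (a + (enorm a * t) *: y) + enorm (a - (enorm a * t) *: y) <=
  2 * enorm a + enorm a * t ^+ 2 * enorm y ^+ 2.
Proof.
set c := enorm a; set A := enorm (_ + _); set B := enorm (_ - _).
have AB : A ^+ 2 + B ^+ 2 = 2 * c ^+ 2 + 2 * (c * t) ^+ 2 * enorm y ^+ 2.
  rewrite !enorm_sq -big_split/= !mulr_sumr -big_split/=.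
  by apply: eq_bigr => i _; rewrite !mxE; ring.
have A0 : 0 <= A := enorm_ge0 _; have B0 : 0 <= B := enorm_ge0 _.
have c0 : 0 <= c := enorm_ge0 _.
have q0 : 0 <= t ^+ 2 * enorm y ^+ 2 by rewrite mulr_ge0 ?sqr_ge0.
rewrite -mulrA; move: q0 AB; set q := t ^+ 2 * _ => q0 AB.
have AB0 : 0 <= A + B by exact: addr_ge0.
have cq0 : 0 <= 2 * c + c * q by apply: addr_ge0; apply: mulr_ge0.
rewrite -ler_sqr ?nnegrE//.
apply: (@le_trans _ _ (2 * (A ^+ 2 + B ^+ 2))).
  by have := sqr_ge0 (A - B); nra.
rewrite AB (_ : 2 * (c * t) ^+ 2 * _ = 2 * (c ^+ 2 * q)); last first.
  by rewrite /q; ring.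
by have := mulr_ge0 (sqr_ge0 c) (sqr_ge0 q); nra.
Qed.

Lemma hlengthE n (u : R -> 'rV[R]_n) : L2v u ->
  hlength u = (prim (fun s => enorm (u s)) 1)%:E.
Proof.
move=> Lu; rewrite /prim /Rintegral fineK//.
exact: integrable_fin_num (L2_integrable (L2_enorm Lu)).
Qed.

End enorms.

Section second_difference.
Context {R : realType} {m : nat}.

(** The moment problem for the functions 1, x_1, ..., x_m and the weight |u|,
    whose right-hand side consists of their values at time 1. *)
Lemma exists_weight (u : R -> 'rV[R]_m) :
  L2v u -> 0 < prim (fun s => enorm (u s)) 1 ->
  exists phi : R -> R, [/\ {within J01, continuous phi},
    prim (fun s => enorm (u s) * phi s) 1 = 1 &
    forall i, prim (fun s => enorm (u s) * phi s * position u s 0 i) 1 =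
              position u 1 0 i].
Proof.
move=> Lu w_gt0; have wi := L2_integrable (L2_enorm Lu).
pose w s := enorm (u s).
(* The index ord0 stands for the constant function 1. *)
pose f (k : 'I_m.+1) s :=
  if unlift ord0 k is Some i then position u s 0 i else 1.
have fc k : {within J01, continuous (f k)}.
  rewrite /f; case: (unlift _ _) => [i|]; last exact: within01_cst.
  exact: position_continuous.
have f0 s : f ord0 s = 1 by rewrite /f unlift_none.
have fS i s : f (lift ord0 i) s = position u s 0 i by rewrite /f liftK.
have [|l lE] := moment_problem (b := fun k => f k 1) fc wi; last first.
  exists (fun s => \sum_j l j * f j s); split.
  - by apply: within01_sum => j; apply: within01M => //; exact: within01_cst.
  - by rewrite -[RHS](f0 1) -(lE ord0); apply: eq_prim => // r _;
      rewrite f0 mulr1.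
  - by move=> i; rewrite -fS -(lE (lift ord0 i)); apply: eq_prim => // r _;
      rewrite fS.
move=> a.
(* The affine function with coefficients a is a ord0 + prim g'. *)
pose g' s := \sum_i a (lift ord0 i) * u s 0 i.
have [g'i g'E] : integrable01 g' /\ forall s, s <= 1 ->
    \sum_k a k * f k s = a ord0 + prim g' s.
  have ai i := integrable01Z (a (lift ord0 i)) (L2_integrable (Lu i)).
  split; first by have [] := prim_sum (lexx 1) ai.
  move=> s s1; rewrite big_ord_recl f0 mulr1 (prim_sum s1 ai).2; congr (_ + _).
  by apply: eq_bigr => i _; rewrite fS primZ ?mxE//; exact: L2_integrable.
have pc := prim_continuous g'i.
have gc : {within J01, continuous (fun s => a ord0 + prim g' s)}.
  by move=> s; apply: continuousD; [exact: within01_cst|exact: pc].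
have lt1 r : I01 r -> r <= 1 by rewrite /= in_itv /= => /andP[_ /ltW].
rewrite (_ : prim _ 1 = prim (fun s => w s * (a ord0 + prim g' s) ^+ 2) 1);
  last first.
  by apply: eq_prim => // r /lt1 r1; rewrite g'E.
move=> int0.
have wg2 : integrable01 (fun s => w s * (a ord0 + prim g' s) ^+ 2).
  by apply: integrable_continuousM => //; exact: within01M.
have gg' : {ae leb, forall s, I01 s -> (a ord0 + prim g' s) * g' s = 0}.
  have := prim_eq0_ae wg2 (fun s _ => mulr_ge0 (enorm_ge0 _) (sqr_ge0 _)) int0.
  apply: ae_imp => s ws /ws /eqP; rewrite mulf_eq0 => /orP[/eqP/enorm_eq0 u0|].
    by rewrite /g' big1 ?mulr0// => i _; rewrite u0 mxE mulr0.
  by rewrite sqrf_eq0 => /eqP ->; rewrite mul0r.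
have sq T : T <= 1 -> (a ord0 + prim g' T) ^+ 2 = a ord0 ^+ 2.
  by move=> T1; exact: prim_square_cst.
have : a ord0 ^+ 2 * prim w 1 = 0.
  by rewrite -primZ// -int0; apply: eq_prim => // r /lt1 r1; rewrite sq// mulrC.
move=> /eqP; rewrite mulf_eq0 (gt_eqF w_gt0) orbF => /eqP a0.
by rewrite g'E//; apply/eqP; rewrite -sqrf_eq0 sq// a0.
Qed.

Lemma ccdist0_hlift (v : R -> 'rV[R]_m) : L2v v ->
  (ccdist0 (hlift v 1) <= hlength v)%E.
Proof.
move=> Lv; apply: ereal_inf_lbound; exists (hlift v), v; split=> //.
  exact: horizontal_hlift.
exact: hlift0.
Qed.

(** The controls u + psi y and u - psi y compete for the distances to the two
    perturbed endpoints, and C controls the integral of |u| phi^2. *)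
Lemma ccdist0_second_difference (u : R -> 'rV[R]_m) :
  L2v u -> 0 < prim (fun s => enorm (u s)) 1 ->
  exists2 C : R, 0 < C & forall y,
    (ccdist0 (hexp y (hlift u 1)) + ccdist0 (hexp (- y) (hlift u 1)) <=
     2%:E * hlength u + (C * enorm y ^+ 2)%:E)%E.
Proof.
move=> Lu w_gt0; have [phi [phic int1 intx]] := exists_weight Lu w_gt0.
have Lw := L2_enorm Lu; have wi := L2_integrable Lw.
pose psi s := enorm (u s) * phi s.
have Lpsi : L2 psi by exact: L2_continuousM.
pose C := prim (fun s => enorm (u s) * (phi s * phi s)) 1.
have C0 : 0 <= C.
  apply: Rintegral_ge0 => s _; rewrite mulr_ge0 ?enorm_ge0//.
  by rewrite -expr2 sqr_ge0.
(* C itself is positive; C + 1 spares a proof of C != 0. *)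
exists (C + 1) => [|y]; first by rewrite ltr_wpDl.
have Lp y' : L2v (fun s => u s + psi s *: y') by exact: L2v_perturb.
have dE y' : (ccdist0 (hexp y' (hlift u 1)) <=
    hlength (fun s => (u s + psi s *: y')%R))%E.
  by rewrite -(hlift_perturb y' Lu Lpsi int1 intx); exact: ccdist0_hlift.
apply: le_trans (leeD (dE y) (dE (- y))) _.
rewrite !hlengthE// -EFinM -!EFinD lee_fin.
have ni y' := L2_integrable (L2_enorm (Lp y')).
have phi2 : {within J01, continuous (fun s => phi s * phi s)}.
  exact: within01M.
have Ci := integrable_continuousM phi2 wi.
rewrite -primD//.
apply: (@le_trans _ _ (2 * prim (fun s => enorm (u s)) 1 + enorm y ^+ 2 * C));
  last first.
  by rewrite lerD2l mulrC ler_wpM2r ?sqr_ge0// lerDl.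
have i2 := integrable01Z 2 wi; have iC := integrable01Z (enorm y ^+ 2) Ci.
rewrite -!primZ// -primD//; apply: le_Rintegral => //.
- exact: integrable01D.
- exact: integrable01D.
move=> s _; rewrite scalerN.
apply: le_trans (enorm_second_difference _ _ _) _.
by rewrite le_eqVlt; apply/orP; left; apply/eqP; ring.
Qed.

End second_difference.

Unset Implicit Arguments.

Theorem mainTheorem3 (R : realType) (m : nat)
    (gamma : R -> free_carnot R m) (u : R -> 'rV[R]_m) (p : free_carnot R m) :
  horizontal gamma u ->
  gamma 0 = 0 ->
  gamma 1 = p ->
  hlength u = ccdist (gamma 0) (gamma 1) ->
  abnormal u ->
  ccdist0 p = 1%E ->
  exists C delta : R, [/\ 0 < C, 0 < delta &
    (ereal_sup
       [set (ccdist0 (hexp y p) + ccdist0 (hexp (- y) p)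
              - 2%:E * ccdist0 p) * ((enorm y ^+ 2)^-1)%:E
       | y in [set y : 'rV[R]_m | (0 < enorm y <= delta)%R]]
     <= C%:E)%E].
Proof.
move=> hu g0 g1 minimal _ dp; have Lu : L2v u := hu.1.
have lu : hlength u = 1%E by rewrite minimal g0 g1.
have pE : p = hlift u 1 by rewrite -g1; exact: horizontal_endpoint.
have w_gt0 : 0 < prim (fun s => enorm (u s)) 1.
  by rewrite -lte_fin -hlengthE// lu lte_fin.
have [C C0 bound] := ccdist0_second_difference Lu w_gt0.
exists C, 1; split => //; apply: ub_ereal_sup => _ [y /andP[y0 _] <-].
have y20 : 0 < enorm y ^+ 2 by rewrite exprn_gt0.
have -> : C%:E = ((C * enorm y ^+ 2)%:E * ((enorm y ^+ 2)^-1)%:E)%E.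
  by rewrite -EFinM mulfK// gt_eqF.
apply: lee_wpmul2r; first by rewrite lee_fin invr_ge0 ltW.
rewrite dp leeBlDr; last by rewrite -EFinM.
by rewrite [leRHS]addeC -lu pE; exact: bound.
Qed.
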